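(* Let $t$ be a closed term. If $\Phi$ is a derivation in the CbN type system of $\vdash^{(m,e)} t : L$ (empty type context, $L$ a linear type), then there is $s$ and an evaluation sequence $d\colon t\to_{\mathrm{cbn}}^{*} s$ with $\mathrm{normal}(s)$, $|d|_m\leq m$ and $|d|_e\leq e$. Moreover, if $\Phi$ is tight then $|d|_m = m$ and $|d|_e=e$.
   Context: Terms: $t,s ::= x \mid \lambda x.t \mid t\,s \mid t[x\leftarrow s]$, where $t[x\leftarrow s]$ (explicit substitution) binds $x$ in $t$. $\mathrm{fv}(t[x\leftarrow s])=(\mathrm{fv}(t)\setminus\{x\})\cup\mathrm{fv}(s)$; closed means no free variables; terms up to $\alpha$-equivalence. Contexts: substitution contexts $S ::= \langle\cdot\rangle \mid S[x\leftarrow t]$; CbN contexts $C ::= \langle\cdot\rangle \mid C\,t \mid C[x\leftarrow t]$; $C\langle t\rangle$ is plugging (may capture), $C\langle\langle t\rangle\rangle$ plugging where $C$ does not capture free variables of $t$. Root steps: $S\langle\lambda x.t\rangle s\mapsto_m S\langle t[x\leftarrow s]\rangle$ (variables bound by $S$ disjoint from $\mathrm{fv}(s)$); $C\langle\langle x\rangle\rangle[x\leftarrow t]\mapsto_e C\langle\langle t\rangle\rangle[x\leftarrow t]$. $\to_{m,\mathrm{cbn}}$ (resp. $\to_{e,\mathrm{cbn}}$) relates $C\langle t'\rangle$ to $C\langle s'\rangle$ for any CbN context $C$ when $t'\mapsto_m s'$ (resp. $\mapsto_e$); $\to_{\mathrm{cbn}}$ is their union. $|d|_m$, $|d|_e$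 count multiplicative and exponential steps of $d$. $\mathrm{normal}$: least predicate with $\mathrm{normal}(\lambda x.t)$ and $\mathrm{normal}(t)\Rightarrow\mathrm{normal}(t[x\leftarrow s])$. CbN types: linear types $L ::= \mathsf{normal}\mid M\to L$; multi types $M ::= [L_i]_{i\in J}$ finite multisets, $\mathbf 0$ the empty multiset, $\uplus$ union. Type contexts $\Gamma$ map variables to multi types, all but finitely many to $\mathbf 0$; $\mathrm{dom}(\Gamma)=\{x\mid\Gamma(x)\neq\mathbf 0\}$; empty if domain empty; $\uplus$ pointwise; $\Gamma,x:M$ means $\Gamma\uplus(x\mapsto M)$ with $x\notin\mathrm{dom}(\Gamma)$; $\Gamma\setminus\!\!\setminus x$ is $\Gamma$ with $x$ mapped to $\mathbf 0$. Rules: (ax) $x:[L]\vdash^{(0,1)} x:L$; (normal) $\vdash^{(0,0)}\lambda x.t:\mathsf{normal}$; (fun) from $\Gamma\vdash^{(m,e)} t:L$ infer $\Gamma\setminus\!\!\setminus x\vdash^{(m,e)}\lambda x.t:\Gamma(x)\to L$; (many) from $\Pi_i\vdash^{(m_i,e_i)} t:L_i$ for $i\in J$ ($J$ finite, possibly empty) infer $\biguplus_i\Pi_i\vdash^{(\sum m_i,\sum e_i)} t:[L_i]_{i\in J}$; (app) from $\Gamma\vdash^{(m,e)} t:M\to L$ and $\Pi\vdash^{(m',e')} s:M$ infer $\Gamma\uplus\Pi\vdash^{(m+m'+1,e+e')} t\,s:L$; (ES) from $\Gamma,x:M\vdash^{(m,e)} t:L$ and $\Pi\vdash^{(m',e')}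 s:M$ infer $\Gamma\uplus\Pi\vdash^{(m+m',e+e')} t[x\leftarrow s]:L$. A derivation of $\Gamma\vdash^{(m,e)} t:L$ is tight if $L=\mathsf{normal}$ and $\Gamma$ is empty. *)

(* Defs.v *)
From HB Require Import structures.
From mathcomp Require Import all_boot.
From mathcomp Require Import finmap.
From mathcomp Require Import multiset.

Set Implicit Arguments.
Unset Strict Implicit.
Unset Printing Implicit Defensive.

Local Open Scope fset_scope.
Local Open Scope mset_scope.
Local Open Scope nat_scope.

(* Terms up to alpha-equivalence are de Bruijn terms.  [ES t s] is the explicit
   substitution t[x<-s]: like [Lam], it binds index 0 in [t]; [s] is outside
   the scope of the binder. *)
Inductive term : Type :=
  | Var of nat
  | Lam of term
  | App of term & term
  | ES of term & term.

Fixpoint free (n : nat) (t : term) : bool :=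
  match t with
  | Var k => k == n
  | Lam u => free n.+1 u
  | App u s => free n u || free n s
  | ES u s => free n.+1 u || free n s
  end.

Definition closed_term (t : term) : Prop := forall n, ~~ free n t.

(* [lift_from c d t] adds [d] to the indices of [t] that are at least [c]. *)
Fixpoint lift_from (c d : nat) (t : term) : term :=
  match t with
  | Var k => Var (if c <= k then d + k else k)
  | Lam u => Lam (lift_from c.+1 d u)
  | App u s => App (lift_from c d u) (lift_from c d s)
  | ES u s => ES (lift_from c.+1 d u) (lift_from c d s)
  end.

(* [lift d t] is the term [t] read under [d] further binders, none of which
   captures a variable of [t]. *)
Definition lift (d : nat) (t : term) : term := lift_from 0 d t.

Inductive sctx : Type :=
  | SHole
  | SSub of sctx & term.

Fixpoint splug (S : sctx) (t : term) : term :=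
  match S with
  | SHole => t
  | SSub S' s => ES (splug S' t) s
  end.

Fixpoint sbinders (S : sctx) : nat :=
  if S is SSub S' _ then (sbinders S').+1 else 0.

Inductive cctx : Type :=
  | CHole
  | CApp of cctx & term
  | CSub of cctx & term.

(* Plugging [C<t>]: the indices of [t] are read inside the hole, so the
   binders of [C] capture its [cbinders C] first ones. *)
Fixpoint plug (C : cctx) (t : term) : term :=
  match C with
  | CHole => t
  | CApp C' s => App (plug C' t) s
  | CSub C' s => ES (plug C' t) s
  end.

Fixpoint cbinders (C : cctx) : nat :=
  match C with
  | CHole => 0
  | CApp C' _ => cbinders C'
  | CSub C' _ => (cbinders C').+1
  end.

(* Capture-free plugging [C<<t>>]: [t] is read outside [C]. *)
Definition plug_nc (C : cctx) (t : term) : term := plug C (lift (cbinders C) t).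

(* The lift of [s] renders the side condition that the variables bound by [S]
   are not free in [s]. *)
Inductive root_m : term -> term -> Prop :=
  | RootM (S : sctx) (t s : term) :
      root_m (App (splug S (Lam t)) s) (splug S (ES t (lift (sbinders S) s))).

(* The replaced occurrence is index 0 read outside [C]; the copy of [t] is
   moved under the explicit substitution, hence [lift 1]. *)
Inductive root_e : term -> term -> Prop :=
  | RootE (C : cctx) (t : term) :
      root_e (ES (plug_nc C (Var 0)) t) (ES (plug_nc C (lift 1 t)) t).

Inductive cbn_closure (R : term -> term -> Prop) : term -> term -> Prop :=
  | CbnClosure (C : cctx) (t s : term) :
      R t s -> cbn_closure R (plug C t) (plug C s).

Definition cbn_m : term -> term -> Prop := cbn_closure root_m.
Definition cbn_e : term -> term -> Prop := cbn_closure root_e.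

Inductive cbn_eval : term -> term -> Type :=
  | EvalNil t : cbn_eval t t
  | EvalM t u s : cbn_m t u -> cbn_eval u s -> cbn_eval t s
  | EvalE t u s : cbn_e t u -> cbn_eval u s -> cbn_eval t s.

Fixpoint size_m t s (d : cbn_eval t s) : nat :=
  match d with
  | EvalNil _ => 0
  | EvalM _ _ _ _ d' => (size_m d').+1
  | EvalE _ _ _ _ d' => size_m d'
  end.

Fixpoint size_e t s (d : cbn_eval t s) : nat :=
  match d with
  | EvalNil _ => 0
  | EvalM _ _ _ _ d' => size_e d'
  | EvalE _ _ _ _ d' => (size_e d').+1
  end.

Inductive normal : term -> Prop :=
  | NormalLam t : normal (Lam t)
  | NormalES t s : normal t -> normal (ES t s).

(* Linear types are freely generated by [normal] and by [M -> L] with [M] a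
   finite multiset of linear types.  An inductive type cannot be nested through
   [{mset _}], so a linear type is a tree in which the multiset on the left of
   an arrow is stored as a list sorted for a fixed total order; [larr] and
   [lnormal] are the constructors on genuine multisets, and [larr_inj],
   [larr_neq_lnormal] and [ltype_ind] state freeness. *)
Inductive rawtype : Type :=
  | RNormal
  | RArr of seq rawtype & rawtype.

Fixpoint raw_encode (r : rawtype) : GenTree.tree unit :=
  match r with
  | RNormal => GenTree.Leaf tt
  | RArr s l => GenTree.Node 0 (raw_encode l :: map raw_encode s)
  end.

Fixpoint raw_decode (t : GenTree.tree unit) : rawtype :=
  match t with
  | GenTree.Leaf _ => RNormal
  | GenTree.Node _ [::] => RNormal
  | GenTree.Node _ (l :: s) => RArr (map raw_decode s) (raw_decode l)
  end.

Definition rawtype_nested_ind (P : rawtype -> Prop) (PN : P RNormal)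
    (PA : forall s l,
       foldr (fun r Q => P r /\ Q) True s -> P l -> P (RArr s l)) :
    forall r, P r :=
  fix ind (r : rawtype) : P r :=
  match r with
  | RNormal => PN
  | RArr s l =>
      PA s l
         ((fix loop (s : seq rawtype) : foldr (fun r Q => P r /\ Q) True s :=
             match s with
             | [::] => I
             | r :: s' => conj (ind r) (loop s')
             end) s)
         (ind l)
  end.

Lemma raw_encodeK : cancel raw_encode raw_decode.
Proof.
elim/rawtype_nested_ind => //= s l IHs ->; congr RArr.
by elim: s IHs => //= r s IH [-> /IH ->].
Qed.

HB.instance Definition _ := Countable.copy rawtype (can_type raw_encodeK).

Definition raw_le (r r' : rawtype) : bool := choice.pickle r <= choice.pickle r'.

Lemma raw_le_total : total raw_le.
Proof. by move=> r r'; apply: leq_total. Qed.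

Lemma raw_le_trans : transitive raw_le.
Proof. by move=> r1 r2 r3; apply: leq_trans. Qed.

Lemma raw_le_anti : antisymmetric raw_le.
Proof.
move=> r r'; rewrite /raw_le -eqn_leq => /eqP.
exact: (pcan_inj choice.pickleK).
Qed.

Fixpoint canonical (r : rawtype) : bool :=
  match r with
  | RNormal => true
  | RArr s l => [&& all canonical s, sorted raw_le s & canonical l]
  end.

Record ltype : Type := LType { raw_of : rawtype; _ : canonical raw_of }.

HB.instance Definition _ := [isSub for raw_of].
HB.instance Definition _ := [Countable of ltype by <:].

Definition mtype := {mset ltype}.

Definition lnormal : ltype := @LType RNormal isT.

Definition raw_arr (M : mtype) (L : ltype) : rawtype :=
  RArr (sort raw_le [seq val K | K <- enum_mset M]) (val L).

Lemma raw_arr_canonical (M : mtype) (L : ltype) : canonical (raw_arr M L).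
Proof.
apply/and3P; split; last exact: (valP L).
  by rewrite all_sort; apply/allP => _ /mapP[K _ ->]; apply: (valP K).
exact: (sort_sorted raw_le_total).
Qed.

Definition larr (M : mtype) (L : ltype) : ltype := LType (raw_arr_canonical M L).

Lemma larr_inj (M M' : mtype) (L L' : ltype) :
  larr M L = larr M' L' -> M = M' /\ L = L'.
Proof.
move=> [eqM eqL]; split; last exact: val_inj.
have /(perm_sortP raw_le_total raw_le_trans raw_le_anti) := eqM.
move=> /(perm_map_inj val_inj) pMM'.
by rewrite -(seq_mset_id M) -(seq_mset_id M'); apply/eq_seq_msetP.
Qed.

Lemma larr_neq_lnormal (M : mtype) (L : ltype) : larr M L <> lnormal.
Proof. by []. Qed.

Lemma ltype_ind (P : ltype -> Prop) :
  P lnormal ->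
  (forall (M : mtype) (L : ltype),
     (forall K, K \in M -> P K) -> P L -> P (larr M L)) ->
  forall L, P L.
Proof.
move=> PN PA [r]; elim/rawtype_nested_ind: r => [|s l IHs IHl] c.
  by rewrite (_ : LType c = lnormal); [exact: PN | exact: val_inj].
have /and3P[cs ss cl] := c.
have [s' s'E] : exists s' : seq ltype, [seq val K | K <- s'] = s.
  elim: s cs {ss c IHs} => [|r s IH] /=; first by exists [::].
  by case/andP=> cr /IH[s' <-]; exists (LType cr :: s').
have PK K : K \in s' -> P K.
  elim: s s' s'E IHs {c cs ss} => [|r s IH] [|K0 s'] //= [<- eqs] [Pr Ps].
  rewrite inE => /predU1P[-> | ]; last exact: IH.
  by case: K0 Pr {eqs} => r0 c0; apply.
rewrite (_ : LType c = larr (seq_mset s') (LType cl)).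
  by apply: PA => [K|]; [rewrite (perm_mem (perm_eq_seq_mset s')); apply: PK |].
apply: val_inj => /=; rewrite /raw_arr /=; congr RArr.
rewrite -(sorted_sort raw_le_trans ss) -s'E.
apply/(perm_sortP raw_le_total raw_le_trans raw_le_anti)/perm_map.
by rewrite perm_sym; apply: perm_eq_seq_mset.
Qed.

Definition tctx := {fsfun nat -> mtype with mset0}.

Definition tdom (G : tctx) : {fset nat} := finsupp G.

Definition tctx0 : tctx := [fsfun].

Definition tctx_single (n : nat) (M : mtype) : tctx := [fsfun n' in [fset n] => M].

Definition tctx_sum (G P : tctx) : tctx :=
  [fsfun n in (finsupp G `|` finsupp P)%fset => G n `+` P n].

(* Leaving the scope of a binder: [tctx_tail G] is [G] with index 0 removed
   and the other indices decremented. *)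
Definition tctx_tail (G : tctx) : tctx :=
  [fsfun n in [fset k.-1 | k in finsupp G] => G n.+1].

Lemma tctx0E n : tctx0 n = mset0.
Proof. by rewrite fsfunE. Qed.

Lemma tctx_singleE n M k : tctx_single n M k = if k == n then M else mset0.
Proof. by rewrite fsfunE inE. Qed.

Lemma tctx_sumE G P n : tctx_sum G P n = G n `+` P n.
Proof.
rewrite fsfunE inE; case: finsuppP => [_|//]; case: finsuppP => [_|//] /=.
by rewrite mset0D.
Qed.

Lemma tctx_tailE G n : tctx_tail G n = G n.+1.
Proof.
rewrite fsfunE; case: ifP => // /negbT nG; apply/esym/fsfun_dflt.
by apply: contra nG => nG; apply/imfsetP; exists n.+1.
Qed.

Lemma tctx_sumA : associative tctx_sum.
Proof. by move=> G P Q; apply/fsfunP => n; rewrite !tctx_sumE msetDA. Qed.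

Lemma tctx_sumC : commutative tctx_sum.
Proof. by move=> G P; apply/fsfunP => n; rewrite !tctx_sumE msetDC. Qed.

Lemma tctx_sum0 : left_id tctx0 tctx_sum.
Proof. by move=> G; apply/fsfunP => n; rewrite tctx_sumE tctx0E mset0D. Qed.

HB.instance Definition _ :=
  Monoid.isComLaw.Build tctx tctx0 tctx_sum tctx_sumA tctx_sumC tctx_sum0.

(* In [TyFun] and [TyES] the bound variable of [t] is index 0 of [G]: [G 0] is
   its multi type and [tctx_tail G] is the rest of the context. *)
Inductive lderiv : tctx -> nat -> nat -> term -> ltype -> Prop :=
  | TyAx n L : lderiv (tctx_single n [mset L]) 0 1 (Var n) L
  | TyNormal t : lderiv tctx0 0 0 (Lam t) lnormal
  | TyFun G m e t L :
      lderiv G m e t L ->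
      lderiv (tctx_tail G) m e (Lam t) (larr (G 0) L)
  | TyApp G P m e m' e' t s M L :
      lderiv G m e t (larr M L) ->
      mderiv P m' e' s M ->
      lderiv (tctx_sum G P) (m + m' + 1) (e + e') (App t s) L
  | TyES G P m e m' e' t s L :
      lderiv G m e t L ->
      mderiv P m' e' s (G 0) ->
      lderiv (tctx_sum (tctx_tail G) P) (m + m') (e + e') (ES t s) L
with mderiv : tctx -> nat -> nat -> term -> mtype -> Prop :=
  | TyMany (J : finType) (P : J -> tctx) (m e : J -> nat) t (L : J -> ltype) :
      (forall i, lderiv (P i) (m i) (e i) t (L i)) ->
      mderiv (\big[tctx_sum/tctx0]_(i : J) P i)
             (\sum_(i : J) m i) (\sum_(i : J) e i) t (seq_mset (codom L)).

Definition tight G m e t L (Phi : lderiv G m e t L) : Prop :=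
  L = lnormal /\ tdom G = fset0.

(* Main.v *)
(* A term is normal, or reduces, or has the shape C<<x>> with x free; typing
   excludes the last case in the empty context, since there the hole of C, and
   hence x, receives a linear type. Each multiplicative (resp. exponential)
   step takes a derivation to one of the same judgement with m (resp. e)
   smaller by exactly one, so evaluation terminates within the bounds. A normal
   term has type [normal] only with both counters 0: its abstraction is typed by
   the rule (normal), so every explicit substitution around it receives the
   multi type 0. This gives equality in the tight case. *)
From mathcomp Require Import all_boot.
From mathcomp Require Import finmap.
From mathcomp Require Import multiset.
Require Import Defs.

Set Implicit Arguments.
Unset Strict Implicit.
Unset Printing Implicit Defensive.

Local Open Scope fset_scope.
Local Open Scope mset_scope.
Local Open Scope nat_scope.

(** * Lifting of de Bruijn indices and progress of CbN evaluation *)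

Lemma lift_from0 c t : lift_from c 0 t = t.
Proof.
by elim: t c => [k|u IH|u IHu s IHs|u IHu s IHs] c /=;
  rewrite ?IH ?IHu ?IHs ?if_same.
Qed.

Lemma lift_lift a b t : lift a (lift b t) = lift (a + b) t.
Proof.
rewrite /lift; elim: t 0 => [k|u IH|u IHu s IHs|u IHu s IHs] c /=;
  rewrite ?IH ?IHu ?IHs //.
case: (leqP c k) => ck; last by rewrite leqNgt ck.
by rewrite (leq_trans ck (leq_addl _ _)) addnA.
Qed.

Lemma normalP t : normal t -> exists S u, t = splug S (Lam u).
Proof.
elim => [u|u s _ [S [v ->]]]; first by exists SHole, u.
by exists (SSub S s), v.
Qed.

Lemma cbn_closure_App (R : term -> term -> Prop) t t' s :
  cbn_closure R t t' -> cbn_closure R (App t s) (App t' s).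
Proof. by case=> C u v Ruv; apply: (CbnClosure (CApp C s)). Qed.

Lemma cbn_closure_ES (R : term -> term -> Prop) t t' s :
  cbn_closure R t t' -> cbn_closure R (ES t s) (ES t' s).
Proof. by case=> C u v Ruv; apply: (CbnClosure (CSub C s)). Qed.

(** Only the left subterm is examined, since CbN contexts never enter an argument. A normal left
    side of an application is an abstraction under explicit substitutions, hence a multiplicative
    redex. *)
Lemma cbn_progress t :
  [\/ normal t, exists s, cbn_m t s, exists s, cbn_e t s
    | exists C n, t = plug_nc C (Var n)].
Proof.
elim: t => [k|u _|u IHu s _|u IHu s _].
- by apply: Or44; exists CHole, k.
- by apply: Or41; apply: NormalLam.
- case: IHu => [/normalP[S [v ->]]|[u' uu']|[u' uu']|[C [n ->]]].
  + apply: Or42; exists (splug S (ES v (lift (sbinders S) s))).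
    exact/(CbnClosure CHole)/RootM.
  + by apply: Or42; exists (App u' s); apply: cbn_closure_App.
  + by apply: Or43; exists (App u' s); apply: cbn_closure_App.
  + by apply: Or44; exists (CApp C s), n.
(* If the variable in the hole is index 0, this explicit substitution binds it and the term is an
   exponential redex; index [n.+1] becomes [n] outside. *)
- case: IHu => [nu|[u' uu']|[u' uu']|[C [[|n] ->]]].
  + by apply: Or41; apply: NormalES.
  + by apply: Or42; exists (ES u' s); apply: cbn_closure_ES.
  + by apply: Or43; exists (ES u' s); apply: cbn_closure_ES.
  + apply: Or43; exists (ES (plug_nc C (lift 1 s)) s).
    exact/(CbnClosure CHole)/RootE.
  + apply: Or44; exists (CSub C s), n.
    by rewrite /plug_nc /lift /= addnS.
Qed.

(** * Type contexts with a fresh variable, and weakening *)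

(** Inserts a fresh index [c] with the empty multi type, the counterpart on contexts of
    [lift_from c 1]. *)
Definition tctx_shift (c : nat) (G : tctx) : tctx :=
  [fsfun n in [fset bump c k | k in finsupp G] =>
     if n == c then mset0 else G (unbump c n)].

Lemma tctx_shiftE c G n :
  tctx_shift c G n = if n == c then mset0 else G (unbump c n).
Proof.
rewrite fsfunE; case: ifP => // /negbT nG; case: eqP => // /eqP nc.
apply/esym/fsfun_dflt; apply: contra nG => nG.
by apply/imfsetP; exists (unbump c n); rewrite ?unbumpKcond //= (negPf nc).
Qed.

Lemma tctx_shift0 c : tctx_shift c tctx0 = tctx0.
Proof. by apply/fsfunP => n; rewrite tctx_shiftE !tctx0E if_same. Qed.

Lemma tctx_shift_single c n M :
  tctx_shift c (tctx_single n M) = tctx_single (bump c n) M.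
Proof.
apply/fsfunP => k; rewrite tctx_shiftE !tctx_singleE.
case: eqP => [->|/eqP kc]; first by rewrite (negPf (neq_bump c n)).
by rewrite -(can_eq (bumpK c)) unbumpKcond (negPf kc).
Qed.

Lemma tctx_shift_sum c G P :
  tctx_shift c (tctx_sum G P) = tctx_sum (tctx_shift c G) (tctx_shift c P).
Proof.
apply/fsfunP => n; rewrite !(tctx_shiftE, tctx_sumE).
by case: ifP; rewrite ?mset0D.
Qed.

Lemma tctx_tail_shiftS c G :
  tctx_tail (tctx_shift c.+1 G) = tctx_shift c (tctx_tail G).
Proof.
apply/fsfunP => n; rewrite !(tctx_tailE, tctx_shiftE) eqSS.
case: eqP => // _; congr (G _); rewrite /unbump ltnS.
case: (ltnP c n) => cn; last by rewrite !subn0.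
by rewrite !subn1 prednK // (leq_ltn_trans _ cn).
Qed.

Lemma tctx_shiftS_0 c G : tctx_shift c.+1 G 0 = G 0.
Proof. by rewrite tctx_shiftE. Qed.

Lemma tctx_shift0_0 G : tctx_shift 0 G 0 = mset0.
Proof. by rewrite tctx_shiftE. Qed.

Lemma tctx_tail_shift0 G : tctx_tail (tctx_shift 0 G) = G.
Proof.
by apply/fsfunP => n; rewrite tctx_tailE tctx_shiftE /= /unbump subn1.
Qed.

Lemma tctx_tail_sum G P :
  tctx_tail (tctx_sum G P) = tctx_sum (tctx_tail G) (tctx_tail P).
Proof. by apply/fsfunP => n; rewrite !(tctx_tailE, tctx_sumE). Qed.

Lemma tctx_tail_singleS n M :
  tctx_tail (tctx_single n.+1 M) = tctx_single n M.
Proof. by apply/fsfunP => k; rewrite !(tctx_tailE, tctx_singleE). Qed.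

Lemma tctx_tail_single0 M : tctx_tail (tctx_single 0 M) = tctx0.
Proof. by apply/fsfunP => k; rewrite !(tctx_tailE, tctx_singleE, tctx0E). Qed.

Lemma tctx_tail0 : tctx_tail tctx0 = tctx0.
Proof. by apply/fsfunP => k; rewrite !(tctx_tailE, tctx0E). Qed.

Scheme lderiv_mut_ind := Minimality for lderiv Sort Prop
  with mderiv_mut_ind := Minimality for mderiv Sort Prop.
Combined Scheme deriv_ind from lderiv_mut_ind, mderiv_mut_ind.

(** Renaming along [bump c] preserves every rule and both counters. Under a binder the shift starts
    at [c.+1], so index 0 keeps the multi type that the rule reads off. *)
Lemma deriv_shift :
  (forall G m e t L, lderiv G m e t L ->
     forall c, lderiv (tctx_shift c G) m e (lift_from c 1 t) L) /\
  (forall P m e t M, mderiv P m e t M ->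
     forall c, mderiv (tctx_shift c P) m e (lift_from c 1 t) M).
Proof.
apply: deriv_ind => /=.
- by move=> n L c; rewrite tctx_shift_single; case: leqP => cn;
    rewrite /bump ?cn ?(leqNgt c) ?cn; apply: TyAx.
- by move=> t c; rewrite tctx_shift0; apply: TyNormal.
- move=> G m e t L _ IH c.
  by rewrite -tctx_tail_shiftS -(tctx_shiftS_0 c G); apply: TyFun.
- move=> G P m e m' e' t s M L _ IHt _ IHs c.
  by rewrite tctx_shift_sum; apply: TyApp (IHt _) (IHs _).
- move=> G P m e m' e' t s L _ IHt _ IHs c.
  rewrite tctx_shift_sum -tctx_tail_shiftS; apply: TyES (IHt _) _.
  by rewrite tctx_shiftS_0.
- move=> J P m e t L _ IH c.
  rewrite (big_morph _ (tctx_shift_sum c) (tctx_shift0 c)).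
  exact: TyMany.
Qed.

Lemma lderiv_lift1 G m e t L :
  lderiv G m e t L -> lderiv (tctx_shift 0 G) m e (lift 1 t) L.
Proof. by move=> /(proj1 deriv_shift)/(_ 0). Qed.

Lemma mderiv_lift1 P m e t M :
  mderiv P m e t M -> mderiv (tctx_shift 0 P) m e (lift 1 t) M.
Proof. by move=> /(proj2 deriv_shift)/(_ 0). Qed.

(** * Selecting premises of the rule (many) *)

(** The rule (many) over a sequence of indices, the form that is left once one premise is removed
    from a finite family. *)
Lemma mderiv_seq (I : Type) (r : seq I) (P : I -> tctx) (m e : I -> nat) t
    (L : I -> ltype) :
  (forall i, lderiv (P i) (m i) (e i) t (L i)) ->
  mderiv (\big[tctx_sum/tctx0]_(i <- r) P i)
         (\sum_(i <- r) m i) (\sum_(i <- r) e i) t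
         (seq_mset [seq L i | i <- r]).
Proof.
move=> der; rewrite !(big_tnth _ _ r).
have -> : [seq L i | i <- r] = codom (fun j => L (tnth (in_tuple r) j)).
  by rewrite /codom /image_mem (map_comp L (tnth (in_tuple r))) map_tnth_enum.
by apply: TyMany => j; apply: der.
Qed.

Lemma mderiv_split P m e t M K :
  mderiv P m e t (M `+` [mset K]) ->
  exists P1 m1 e1 P2 m2 e2,
    [/\ lderiv P1 m1 e1 t K, mderiv P2 m2 e2 t M, P = tctx_sum P1 P2,
        m = m1 + m2 & e = e1 + e2].
Proof.
move EN: (M `+` [mset K]) => N der.
case: der EN => {P m e t N} J P m e t L der EN.
have /codomP[i Ki] : K \in codom L.
  rewrite -(perm_mem (perm_eq_seq_mset (codom L))) -EN.
  by rewrite in_msetD in_mset1 eqxx orbT.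
have iJ : i \in index_enum J by apply: mem_index_enum.
exists (P i), (m i), (e i); rewrite !(big_rem _ iJ) /=.
do 3!eexists; split; first (by rewrite Ki; apply: der); try by [].
have -> : M = seq_mset [seq L j | j <- rem i (index_enum J)].
  (* With [K] added back on both sides, each side is the multiset of all the types [L j]. *)
  apply: (can_inj (msetDKBC [mset K])); rewrite EN Ki msetDC -mset_cons.
  apply/eq_seq_msetP; rewrite -map_cons perm_map //.
  apply: perm_trans (perm_to_rem iJ).
  by rewrite perm_sym [index_enum J]unlock enumT.
exact: mderiv_seq.
Qed.

(** Any premise would put its type into the empty multiset, so the family of premises is empty. *)
Lemma mderiv0 P m e t : mderiv P m e t mset0 -> [/\ P = tctx0, m = 0 & e = 0].
Proof.
move EN: mset0 => N der; case: der EN => {P m e t N} J P m e t L _ EN.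
suff J0 (i : J) : False by split; apply: big1 => i; case: (J0 i).
have := codom_f L i.
by rewrite -(perm_mem (perm_eq_seq_mset (codom L))) -EN in_mset0.
Qed.

(** * Inversion of the typing rules *)

Lemma lderiv_Var_inv G m e n L :
  lderiv G m e (Var n) L -> [/\ G = tctx_single n [mset L], m = 0 & e = 1].
Proof.
by move Et: (Var n) => t der; case: der Et => // k K [->].
Qed.

Lemma lderiv_Lam_arr_inv G m e t M L :
  lderiv G m e (Lam t) (larr M L) ->
  exists G', [/\ lderiv G' m e t L, M = G' 0 & G = tctx_tail G'].
Proof.
move Et: (Lam t) => t'; move EL: (larr M L) => L' der.
case: der Et EL => // G' m' e' t'' L'' der [->] /larr_inj[-> ->].
by exists G'.
Qed.

Lemma lderiv_Lam_normal_inv G m e t :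
  lderiv G m e (Lam t) lnormal -> [/\ G = tctx0, m = 0 & e = 0].
Proof.
move Et: (Lam t) => t'; move EL: lnormal => L' der.
by case: der Et EL => // G' m' e' t'' L'' _ _ /esym/larr_neq_lnormal.
Qed.

Lemma lderiv_App_inv G m e t s L :
  lderiv G m e (App t s) L ->
  exists M G1 m1 e1 G2 m2 e2,
    [/\ lderiv G1 m1 e1 t (larr M L), mderiv G2 m2 e2 s M,
        G = tctx_sum G1 G2, m = m1 + m2 + 1 & e = e1 + e2].
Proof.
move Et: (App t s) => t' der.
case: der Et => // G1 G2 m1 e1 m2 e2 t1 s1 M L1 der1 der2 [-> ->].
by exists M, G1, m1, e1, G2, m2, e2.
Qed.

Lemma lderiv_ES_inv G m e t s L :
  lderiv G m e (ES t s) L ->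
  exists G1 m1 e1 G2 m2 e2,
    [/\ lderiv G1 m1 e1 t L, mderiv G2 m2 e2 s (G1 0),
        G = tctx_sum (tctx_tail G1) G2, m = m1 + m2 & e = e1 + e2].
Proof.
move Et: (ES t s) => t' der.
case: der Et => // G1 G2 m1 e1 m2 e2 t1 s1 L1 der1 der2 [-> ->].
by exists G1, m1, e1, G2, m2, e2.
Qed.

(** * Typing of normal terms, multiplicative redexes and plugged variables *)

Lemma lderiv_normal G m e t :
  normal t -> lderiv G m e t lnormal -> [/\ G = tctx0, m = 0 & e = 0].
Proof.
move=> nt; elim: nt G m e => [u|u s _ IH] G m e.
  exact: lderiv_Lam_normal_inv.
move=> /lderiv_ES_inv[G1 [m1 [e1 [G2 [m2 [e2 [/IH[-> -> ->]]]]]]]].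
by rewrite tctx0E tctx_tail0 => /mderiv0[-> -> ->] -> -> ->; rewrite tctx_sum0.
Qed.

(** The derivation of [s] is pushed through [S], lifted at each binder, down to the abstraction.
    There the premise of (fun) and the derivation of [s] are the premises of (ES), which unlike
    (app) adds no 1. *)
Lemma lderiv_splug_beta S G P m e m' e' t s M L :
  lderiv G m e (splug S (Lam t)) (larr M L) -> mderiv P m' e' s M ->
  lderiv (tctx_sum G P) (m + m') (e + e')
    (splug S (ES t (lift (sbinders S) s))) L.
Proof.
elim: S G P m e m' e' s => [|S IH r] G P m e m' e' s /=.
  move=> /lderiv_Lam_arr_inv[G' [der -> ->]] ders.
  by rewrite /lift lift_from0; apply: TyES.
move=> /lderiv_ES_inv[G1 [m1 [e1 [G2 [m2 [e2 [der derr -> -> ->]]]]]]] ders.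
have := IH _ _ _ _ _ _ _ der (mderiv_lift1 ders).
rewrite lift_lift addn1 => der'.
rewrite -tctx_sumA (tctx_sumC G2) tctx_sumA.
(* [P] is read as the tail of its own shift, which lets it enter the scope of the binder; the shift
   is empty at index 0, so [r] keeps its multi type. *)
rewrite -[X in tctx_sum (tctx_sum _ X)]tctx_tail_shift0 -tctx_tail_sum.
rewrite -!addnA (addnC m2) (addnC e2) !addnA.
by apply: TyES der' _; rewrite tctx_sumE tctx_shift0_0 msetD0.
Qed.

(* The hole of a CbN context is never inside an argument, hence it is typed
   exactly once: with a linear type [K], not with a multi type. *)
Lemma lderiv_plug_Var C n G m e L :
  lderiv G m e (plug_nc C (Var n)) L ->
  exists K G' e',
    [/\ G = tctx_sum G' (tctx_single n [mset K]), e = e' + 1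
      & forall P m1 e1 u, lderiv P m1 e1 u K ->
          lderiv (tctx_sum G' P) (m + m1) (e' + e1) (plug_nc C u) L].
Proof.
(* Only the lift of the variable is computed, to index [cbinders C + n], which suits the induction
   on [C]. *)
rewrite /plug_nc {1}/lift /=.
elim: C n G m e L => [|C IH s|C IH s] n G m e L /=.
- move=> /lderiv_Var_inv[-> -> ->]; exists L, tctx0, 0.
  rewrite tctx_sum0; split=> // P m1 e1 u.
  by rewrite tctx_sum0 /lift lift_from0.
- move=> /lderiv_App_inv[M [G1 [m1 [e1 [G2 [m2 [e2 [der ders -> -> ->]]]]]]]].
  have [K [G' [e' [-> -> derC]]]] := IH _ _ _ _ _ der.
  exists K, (tctx_sum G' G2), (e' + e2).
  split=> [||P m3 e3 u /derC deru].
  + by rewrite -!tctx_sumA (tctx_sumC G2).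
  + by rewrite addnAC.
  + rewrite -tctx_sumA (tctx_sumC G2) tctx_sumA (addnAC e').
    rewrite (addnAC _ 1) (addnAC m1).
    exact: TyApp deru ders.
- move=> /lderiv_ES_inv[G1 [m1 [e1 [G2 [m2 [e2 [der ders -> -> ->]]]]]]].
  (* The extra binder is charged to the variable: inside, it is [n.+1]. *)
  move: der; rewrite addSnnS => /IH[K [G' [e' [EG1 -> derC]]]].
  have EG10 : G1 0 = G' 0 by rewrite EG1 tctx_sumE tctx_singleE msetD0.
  exists K, (tctx_sum (tctx_tail G') G2), (e' + e2).
  split=> [||P m3 e3 u /lderiv_lift1/derC].
  + by rewrite EG1 tctx_tail_sum tctx_tail_singleS -!tctx_sumA (tctx_sumC G2).
  + by rewrite addnAC.
  + rewrite lift_lift addn1 => deru.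
    rewrite -tctx_sumA (tctx_sumC G2) tctx_sumA (addnAC e') (addnAC m1).
    rewrite -[X in tctx_sum (tctx_sum _ X)]tctx_tail_shift0 -tctx_tail_sum.
    by apply: TyES deru _; rewrite tctx_sumE tctx_shift0_0 msetD0 -EG10.
Qed.

Lemma lderiv_plug_Var_neq0 C n G m e L :
  lderiv G m e (plug_nc C (Var n)) L -> G <> tctx0.
Proof.
move=> /lderiv_plug_Var[K [G' [e' [-> _ _]]]] /fsfunP/(_ n)/msetP/(_ K).
by rewrite tctx_sumE tctx0E tctx_singleE eqxx msetE2 msetnE mset0E eqxx addn1.
Qed.

(** * Quantitative subject reduction *)

(** Quantified over all contexts and linear types, so that it can be applied to a redex at the hole
    of any CbN context. *)
Definition lderiv_drop (a b : nat) (t s : term) : Prop :=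
  forall G m e L, lderiv G m e t L ->
    exists m' e', [/\ lderiv G m' e' s L, m = m' + a & e = e' + b].

(** The hole is typed exactly once, so the drop is neither lost nor multiplied. *)
Lemma lderiv_drop_plug a b C t s :
  lderiv_drop a b t s -> lderiv_drop a b (plug C t) (plug C s).
Proof.
move=> drop; elim: C => //= C IH r G m e L.
- move=> /lderiv_App_inv[M [G1 [m1 [e1 [G2 [m2 [e2 [der derr -> -> ->]]]]]]]].
  have [m' [e' [der' -> ->]]] := IH _ _ _ _ der.
  exists (m' + m2 + 1), (e' + e2).
  split; first exact: TyApp der' derr.
  + by rewrite !(addnAC _ a).
  + by rewrite addnAC.
- move=> /lderiv_ES_inv[G1 [m1 [e1 [G2 [m2 [e2 [der derr -> -> ->]]]]]]].
  have [m' [e' [der' -> ->]]] := IH _ _ _ _ der.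
  exists (m' + m2), (e' + e2).
  by split; [exact: TyES der' derr | rewrite addnAC | rewrite addnAC].
Qed.

Lemma cbn_m_lderiv t s : cbn_m t s -> lderiv_drop 1 0 t s.
Proof.
case=> C _ _ [S u r]; apply: lderiv_drop_plug => G m e L.
move=> /lderiv_App_inv[M [G1 [m1 [e1 [G2 [m2 [e2 [der derr -> -> ->]]]]]]]].
exists (m1 + m2), (e1 + e2).
by rewrite addn0; split=> //; apply: lderiv_splug_beta der derr.
Qed.

Lemma cbn_e_lderiv t s : cbn_e t s -> lderiv_drop 0 1 t s.
Proof.
case=> C _ _ [D r]; apply: lderiv_drop_plug => G m e L.
move=> /lderiv_ES_inv[G1 [m1 [e1 [G2 [m2 [e2 [der derr -> -> ->]]]]]]].
have [K [G' [e' [EG1 -> derD]]]] := lderiv_plug_Var der.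
(* The multi type of index 0 is [G' 0] plus [K]: the premise for [K] types the copy placed in the
   hole, the others type the [r] that remains. The axiom at the hole, worth 1 in [e], disappears. *)
move: derr; rewrite EG1 tctx_sumE tctx_singleE eqxx.
move=> /mderiv_split[P1 [m3 [e3 [P2 [m4 [e4 [derK derM -> -> ->]]]]]]].
exists (m1 + (m3 + m4)), (e' + (e3 + e4)).
split; [|by rewrite addn0|by rewrite addnAC].
rewrite tctx_tail_sum tctx_tail_single0 (tctx_sumC _ tctx0) tctx_sum0.
rewrite tctx_sumA !addnA.
rewrite -[X in tctx_sum (tctx_sum _ X)]tctx_tail_shift0 -tctx_tail_sum.
apply: TyES (derD _ _ _ _ (lderiv_lift1 derK)) _.
by rewrite tctx_sumE tctx_shift0_0 msetD0.
Qed.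

(** * Termination within the bounds *)

Lemma lderiv_eval m e t L :
  lderiv tctx0 m e t L ->
  exists (s : term) (d : cbn_eval t s),
    [/\ normal s, size_m d <= m, size_e d <= e &
        L = lnormal -> size_m d = m /\ size_e d = e].
Proof.
(* Each step lowers one of the two counters by one and keeps the other, so their sum is the
   measure. *)
have [k] := ubnP (m + e); elim: k m e t => // k IH m e t.
rewrite ltnS => me_k der.
have [nt|[u tu]|[u tu]|[C [n Et]]] := cbn_progress t.
- exists t, (EvalNil t); split=> // EL; move: der; rewrite EL.
  by case/(lderiv_normal nt) => _ -> ->.
- have [m' [e' [der' Em Ee]]] := cbn_m_lderiv tu der.
  move: me_k; rewrite Em Ee addn0 addn1 addSn => me_k.
  have [s [d [ns dm de dL]]] := IH _ _ _ me_k der'.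
  by exists s, (EvalM tu d); split=> //= /dL[-> ->].
- have [m' [e' [der' Em Ee]]] := cbn_e_lderiv tu der.
  move: me_k; rewrite Em Ee addn0 addn1 addnS => me_k.
  have [s [d [ns dm de dL]]] := IH _ _ _ me_k der'.
  by exists s, (EvalE tu d); split=> //= /dL[-> ->].
- by move: der; rewrite Et => /lderiv_plug_Var_neq0.
Qed.

Theorem theorem1 (t : term) (ht : closed_term t) (m e : nat) (L : ltype)
    (Phi : lderiv tctx0 m e t L) :
  exists (s : term) (d : cbn_eval t s),
    [/\ normal s, (size_m d <= m)%N, (size_e d <= e)%N &
        tight Phi -> size_m d = m /\ size_e d = e].
Proof.
have [s [d [ns dm de dL]]] := lderiv_eval Phi.
by exists s, d; split=> // -[/dL].
Qed.
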